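(* Let $f:\mathbb{R}^m\to\mathbb{R}$ be a $C^2$-smooth function, let $\Theta=\{x:\nabla f(x)=0,\ \nabla^2f(x)\succeq0\}$, and let $\overline{x}\in\Theta$. Suppose that either one of the following conditions holds: (i) $f$ satisfies the strict saddle point property and the KL property at $\overline{x}$ with the KL exponent $\theta$. (ii) $f=\varphi\circ g$, where $\varphi:\mathbb{R}^n\to\mathbb{R}$ is a convex function satisfying the KL property at $g(\overline{x})$ with the KL exponent $\theta$, and where $g:\mathbb{R}^m\to\mathbb{R}^n$ is a smooth mapping with surjective derivative $\nabla g(\overline{x})$. Then $\nabla f$ has the generalized metric subregularity property at $\overline{x}$ with respect to $(\psi,\Theta)$, where $\psi(t)=t^{\frac{\theta}{1-\theta}}$; that is, there exist $\kappa,\delta\in(0,\infty)$ such that $\psi(d(x,\Theta))\le\kappa\|\nabla f(x)\|$ for all $x$ with $\|x-\overline{x}\|<\delta$.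
   Context: $d(x,S)$ is the Euclidean distance from $x$ to $S$. ''Smooth mapping'' means continuously differentiable. Strict saddle point property at $\overline{x}$ with $\nabla f(\overline x)=0$: $\overline{x}$ is either a local minimizer of $f$ or satisfies $\lambda_{\min}(\nabla^2f(\overline{x}))<0$. KL property with exponent $\theta\in[0,1)$: a proper l.s.c. function $h$ satisfies the KL property at $\overline{z}$ with KL exponent $\theta$ if there exist $c>0$, $\eta>0$, $\varepsilon>0$ such that, with $\vartheta(t)=c\,t^{1-\theta}$ on $[0,\eta)$, one has $\vartheta'(h(z)-h(\overline{z}))\,d(0,\partial h(z))\ge1$ for all $z$ with $\|z-\overline{z}\|<\varepsilon$ and $h(\overline{z})<h(z)<h(\overline{z})+\eta$. Here $\partial h$ is the limiting (Mordukhovich) subdifferential, which equals $\{\nabla h(z)\}$ for $C^1$ functions and the convex subdifferential for convex functions. *)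

(* Defs.v *)
From HB Require Import structures.
From mathcomp Require Export all_boot all_order all_algebra.
From mathcomp Require Export all_classical all_reals all_analysis.

Set Implicit Arguments.
Unset Strict Implicit.
Unset Printing Implicit Defensive.

Export Order.TTheory GRing.Theory Num.Theory.
Export numFieldNormedType.Exports.

Local Open Scope classical_set_scope.
Local Open Scope ring_scope.

(* The library norm on 'rV[R]_m is the sup norm. It induces the Euclidean
   topology, so library notions that are only topological (nbhs, continuous,
   differentiable) can be used as they are. *)
Definition dotr (R : realType) (m : nat) (u v : 'rV[R]_m) : R :=
  \sum_i u 0 i * v 0 i.

Definition norm2 (R : realType) (m : nat) (u : 'rV[R]_m) : R :=
  Num.sqrt (dotr u u).

(* Distance in the extended reals: it is +oo for the empty set. *)
Definition dist2 (R : realType) (m : nat) (x : 'rV[R]_m) (S : set 'rV[R]_m) :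
    \bar R :=
  ereal_inf [set (norm2 (x - y))%:E | y in S].

Definition grad (R : realType) (m : nat) (f : 'rV[R]_m -> R) (x : 'rV[R]_m) :
    'rV[R]_m :=
  \row_i 'D_(delta_mx 0 i) f x.

(* The (i, j) entry is the i-th partial derivative of the j-th component of
   the gradient. *)
Definition hess (R : realType) (m : nat) (f : 'rV[R]_m -> R) (x : 'rV[R]_m) :
    'M[R]_m :=
  jacobian (grad f) x.

Definition C1_map (R : realType) (m n : nat) (g : 'rV[R]_m -> 'rV[R]_n) :
    Prop :=
  (forall x, differentiable g x) /\ continuous (jacobian g).

Definition C2_fun (R : realType) (m : nat) (f : 'rV[R]_m -> R) : Prop :=
  (forall x, differentiable f x) /\ C1_map (grad f).

Definition psd (R : realType) (m : nat) (A : 'M[R]_m) : Prop :=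
  forall v : 'rV[R]_m, 0 <= dotr (v *m A) v.

(* Used for symmetric A only, where the spectrum is real. *)
Definition lambda_min (R : realType) (m : nat) (A : 'M[R]_m) : R :=
  inf [set a : R | eigenvalue A a].

Definition local_minimizer (R : realType) (m : nat) (f : 'rV[R]_m -> R)
    (x : 'rV[R]_m) : Prop :=
  \forall z \near x, f x <= f z.

Definition strict_saddle (R : realType) (m : nat) (f : 'rV[R]_m -> R)
    (x : 'rV[R]_m) : Prop :=
  grad f x = 0 /\ (local_minimizer f x \/ lambda_min (hess f x) < 0).

(* v is a regular (Frechet) subgradient of h at x:
   h z >= h x + <v, z - x> + o(|z - x|) as z --> x. *)
Definition regular_subdiff (R : realType) (m : nat) (h : 'rV[R]_m -> \bar R)
    (x : 'rV[R]_m) : set 'rV[R]_m :=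
  [set v | h x \is a fin_num /\
    forall e : R, 0 < e ->
      \forall z \near x,
        (h x + (dotr v (z - x) - e * norm2 (z - x))%:E <= h z)%E].

(* Mordukhovich subdifferential *)
Definition limiting_subdiff (R : realType) (m : nat) (h : 'rV[R]_m -> \bar R)
    (x : 'rV[R]_m) : set 'rV[R]_m :=
  [set v | h x \is a fin_num /\
    exists xk vk : nat -> 'rV[R]_m,
      [/\ xk k @[k --> \oo] --> x,
          h (xk k) @[k --> \oo] --> h x,
          forall k, regular_subdiff h (xk k) (vk k) &
          vk k @[k --> \oo] --> v]].

(* [fine] is applied to a finite value here: the hypotheses on h z force both
   h z and h zbar to be finite. *)
Definition KL_property (R : realType) (m : nat) (h : 'rV[R]_m -> \bar R)
    (zbar : 'rV[R]_m) (theta : R) : Prop :=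
  exists c eta eps : R, [/\ 0 < c, 0 < eta, 0 < eps &
    forall z : 'rV[R]_m, norm2 (z - zbar) < eps ->
      (h zbar < h z)%E -> (h z < h zbar + eta%:E)%E ->
      (1 <= (derive1 (fun t : R => c * t `^ (1 - theta))
               (fine (h z - h zbar)))%:E
            * dist2 0 (limiting_subdiff h z))%E].

(* t |-> t ^ (theta / (1 - theta)) on [0, +oo[, with value 0 at 0. The case
   distinction matters for theta = 0 only: the library has 0 `^ 0 = 1, but the
   gauge functions of generalized metric subregularity vanish at 0. *)
Definition psi_of (R : realType) (theta t : R) : R :=
  if t == 0 then 0 else t `^ (theta / (1 - theta)).

(* The bound is only meaningful for nonempty S, where dist2 x S is finite. *)
Definition gen_metric_subregular (R : realType) (m n : nat)
    (F : 'rV[R]_m -> 'rV[R]_n) (xbar : 'rV[R]_m) (psi : R -> R)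
    (S : set 'rV[R]_m) : Prop :=
  exists kappa delta : R, [/\ 0 < kappa, 0 < delta &
    forall x : 'rV[R]_m, norm2 (x - xbar) < delta ->
      psi (fine (dist2 x S)) <= kappa * norm2 (F x)].

Definition second_order_stationary (R : realType) (m : nat)
    (f : 'rV[R]_m -> R) : set 'rV[R]_m :=
  [set x | grad f x = 0 /\ psd (hess f x)].

(* Main.v *)
Require Import Defs.
From mathcomp Require Import ring lra.

(** In both cases [xbar] is a local minimizer of [f], and a gradient inequality
    [(f x - f xbar) ^ theta <= C * norm2 (grad f x)] holds for the points [x] near
    [xbar] with [f x] slightly above [f xbar].

    The gradient inequality implies the conclusion
    ([gradient_KL_subregular]). It bounds from below the slope of
    [F := (f - f xbar) ^ (1 - theta)] where [F] is positive. By a variational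
    principle in the style of Ekeland ([near_minimizer]), every [x] near [xbar]
    then has a point [y] with [f y = f xbar] at distance at most a multiple of
    [F x]. Such a [y] is a local minimizer of [f], so it satisfies the
    second-order necessary conditions ([local_minimizer_stationary]), and
    the distance from [x] to the second-order stationary set is at most a multiple
    of [(f x - f xbar) ^ (1 - theta)]. Raising to the power
    [theta / (1 - theta)] and using the gradient inequality once more gives the
    claim.

    In the strict saddle case, the Hessian at [xbar] has no negative eigenvalue,
    so [xbar] is a local minimizer, and the gradient inequality is the KL property
    read at the limiting subgradient [grad f x].

    In the composite case [f = phi \o g], let [B] be a right inverse of the
    Jacobian of [g] at [x]. Convexity and differentiability of the composite
    imply that the gradient of [f] pulled back along [B] is a subgradient of [phi]
    at [g x] ([convex_comp_subgradient]). At [xbar] this subgradient is 0, so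
    [g xbar] minimizes [phi] and [xbar] minimizes [f]. Near [xbar] the right
    inverses can be chosen uniformly bounded
    ([near_convex_comp_subgradient]), so the KL property of [phi] becomes the
    gradient inequality for [f]. *)

Set Implicit Arguments.
Unset Strict Implicit.
Unset Printing Implicit Defensive.

Local Open Scope classical_set_scope.
Local Open Scope ring_scope.

(** * Euclidean and sup norms *)

Lemma normr_mxE (R : realType) k n (A : 'M[R]_(k, n)) i j : `|A i j| <= `|A|.
Proof.
rewrite [leRHS]/Num.Def.normr /= mx_normrE.
by apply/bigmax_geP; right; exists (i, j).
Qed.

Section Euclidean.
Context {R : realType} {m : nat}.
Implicit Types u v w : 'rV[R]_m.

Lemma dotrZl a u v : dotr (a *: u) v = a * dotr u v.
Proof. by rewrite /dotr mulr_sumr; apply: eq_bigr => i _; rewrite !mxE mulrA. Qed.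

Lemma dotrZr a u v : dotr u (a *: v) = a * dotr u v.
Proof. by rewrite /dotr mulr_sumr; apply: eq_bigr => i _; rewrite !mxE mulrCA. Qed.

Lemma dotrNr u v : dotr u (- v) = - dotr u v.
Proof. by rewrite -scaleN1r dotrZr mulN1r. Qed.

Lemma dotr0l v : dotr 0 v = 0.
Proof. by rewrite -(scale0r v) dotrZl mul0r. Qed.

Lemma dotr_mulmx n (u : 'rV[R]_n) (B : 'M[R]_(m, n)) v :
  dotr (v *m B) u = dotr v (u *m B^T).
Proof.
have dE k (a b : 'rV[R]_k) : dotr a b = (a *m b^T) 0 0.
  by rewrite mxE; apply: eq_bigr => i _; rewrite mxE.
by rewrite !dE trmx_mul trmxK mulmxA.
Qed.

Lemma dotr_ge0 u : 0 <= dotr u u.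
Proof. by apply: sumr_ge0 => i _; rewrite -expr2 sqr_ge0. Qed.

Lemma norm2_ge0 u : 0 <= norm2 u.
Proof. exact: sqrtr_ge0. Qed.

Lemma norm2_sqr u : norm2 u ^+ 2 = dotr u u.
Proof. exact/sqr_sqrtr/dotr_ge0. Qed.

Lemma norm2_0 : norm2 (0 : 'rV[R]_m) = 0.
Proof. by rewrite /norm2 dotr0l sqrtr0. Qed.

Lemma norm2N u : norm2 (- u) = norm2 u.
Proof. by rewrite /norm2 -scaleN1r dotrZl dotrZr !mulN1r opprK. Qed.

Lemma normr_le_coord u (M : R) : 0 <= M -> (forall i, `|u 0 i| <= M) -> `|u| <= M.
Proof.
move=> M0 uM; rewrite [leLHS]/Num.Def.normr /= mx_normrE.
by apply: bigmax_le => // -[i j] _ /=; rewrite ord1.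
Qed.

Lemma normr_le_norm2 u : `|u| <= norm2 u.
Proof.
apply: normr_le_coord => [|i]; first exact: norm2_ge0.
rewrite -ler_sqr ?nnegrE ?norm2_ge0// norm2_sqr real_normK ?num_real//.
rewrite /dotr (bigD1 i)//= -expr2 lerDl.
by apply: sumr_ge0 => j _; rewrite -expr2 sqr_ge0.
Qed.

Lemma norm2_le_normr u : norm2 u <= Num.sqrt m%:R * `|u|.
Proof.
rewrite -ler_sqr ?nnegrE ?norm2_ge0 ?mulr_ge0 ?sqrtr_ge0//.
rewrite norm2_sqr exprMn sqr_sqrtr ?ler0n// /dotr.
have -> : m%:R * `|u| ^+ 2 = \sum_(i < m) `|u| ^+ 2.
  by rewrite sumr_const card_ord mulr_natl.
apply: ler_sum => i _; rewrite -expr2 -(real_normK (num_real _)).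
by rewrite ler_sqr ?nnegrE// normr_mxE.
Qed.

(** Neighbourhoods are those of the sup norm; this lemma and the next
    one let Euclidean balls be used in their place. *)
Lemma near_norm2 (x : 'rV[R]_m) (e : R) : 0 < e ->
  \forall z \near x, norm2 (z - x) < e.
Proof.
move=> e0; have K0 : 0 < Num.sqrt m%:R + 1 :> R.
  by rewrite ltr_wpDl ?sqrtr_ge0.
near=> z; apply: le_lt_trans (norm2_le_normr _) _.
apply: (@le_lt_trans _ _ ((Num.sqrt m%:R + 1) * `|z - x|)).
  by rewrite ler_wpM2r ?lerDl.
rewrite mulrC -ltr_pdivlMr// distrC.
near: z; apply: cvgr_dist_lt => //; exact: divr_gt0.
Unshelve. all: by end_near. Qed.

Lemma norm2_nbhs (x : 'rV[R]_m) (P : set 'rV[R]_m) :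
  (\forall z \near x, P z) ->
  exists2 e : R, 0 < e & forall z, norm2 (z - x) < e -> P z.
Proof.
move=> /nbhs_ballP[e /= e0 xP]; exists e => // z zx; apply: xP.
by rewrite -ball_normE /= distrC (le_lt_trans (normr_le_norm2 _)).
Qed.

Lemma near_in_ball (c y : 'rV[R]_m) (r : R) : `|y - c| < r ->
  \forall z \near y, `|z - c| < r.
Proof.
move=> yr; near=> z; have zy : `|y - z| < r - `|y - c|.
  by near: z; apply: cvgr_dist_lt => //; rewrite subr_gt0.
by have := ler_distD y z c; rewrite (distrC z y); lra.
Unshelve. all: by end_near. Qed.

Lemma dist2_le (x y : 'rV[R]_m) (S : set 'rV[R]_m) : S y ->
  0 <= fine (dist2 x S) <= norm2 (x - y).
Proof.
move=> Sy; have d0 : (0 <= dist2 x S)%E.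
  by apply/le_ereal_inf_tmp => _ [z _ <-]; rewrite lee_fin norm2_ge0.
have dle : (dist2 x S <= (norm2 (x - y))%:E)%E by apply: ereal_inf_lbound; exists y.
rewrite fine_ge0//= -lee_fin fineK// fin_numE.
by apply/andP; split; apply/eqP => dE; move: d0 dle; rewrite dE.
Qed.

End Euclidean.

(** * Derivatives along lines *)

Section Lines.
Context {R : realType} {m : nat}.

Lemma is_derive_line (W : normedModType R) (f : 'rV[R]_m -> W)
    (x w : 'rV[R]_m) (t : R) : differentiable f (x + t *: w) ->
  is_derive t 1 (fun s => f (x + s *: w)) ('d f (x + t *: w) w).
Proof.
move=> df; have dl : is_diff t (fun s : R => x + s *: w) ( *:%R^~ w).
  by apply: is_diff_eq; rewrite add0r.
have dfl : is_diff t (f \o (fun s : R => x + s *: w))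
    ('d f (x + t *: w) \o ( *:%R^~ w)).
  by apply: is_diff_comp; exact: DiffDef.
have [dd de] := dfl.
split; first exact/derivable1_diffP.
by rewrite deriveE// -[LHS]/('d (f \o (fun s : R => x + s *: w)) t 1) de /= scale1r.
Qed.

Lemma diff_grad (f : 'rV[R]_m -> R) (x w : 'rV[R]_m) : differentiable f x ->
  'd f x w = dotr (grad f x) w.
Proof.
move=> df; rewrite {1}(row_sum_delta w) linear_sum.
by apply: eq_bigr => i _; rewrite linearZ mxE deriveE// mulrC.
Qed.

(** The inequalities that minimality and convexity provide for [t > 0] pass to
    the derivative through one-sided difference quotients. *)
Lemma derivable_cvg_right (V W : normedModType R) (f : V -> W) (x w : V) :
  derivable f x w ->
  (fun t : R => t^-1 *: (f (t *: w + x) - f x)) @ 0^'+ --> 'D_w f x.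
Proof.
by move=> fd; apply: cvg_dnbhs_at_right; exact: fd.
Qed.

Lemma derive_ge_right (h : R -> R) (D b : R) : is_derive (0 : R) (1 : R) h D ->
  (\forall t \near 0^'+, h 0 - b * t <= h t) -> - b <= D.
Proof.
move=> [hd <-] hb; have hq := derivable_cvg_right hd.
rewrite -(cvg_lim _ hq)//; apply: limr_ge; first by apply/cvg_ex; exists ('D_1 h 0).
near=> t.
have t0 : 0 < t by [].
rewrite addr0 /GRing.scale /= mulr1 ler_pdivlMl// mulrN mulrC lerBrDl.
by near: t.
Unshelve. all: by end_near. Qed.

End Lines.

(** * Second-order necessary conditions *)

Section SecondOrder.
Context {R : realType} {m : nat}.
Implicit Types (f : 'rV[R]_m -> R) (x y v w : 'rV[R]_m).

Lemma continuous_dotrl v : continuous (fun u : 'rV[R]_m => dotr u v).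
Proof.
apply: continuous_big => [p|i _ u]; first exact: add_continuous.
by apply: (@continuousM _ _ (fun u : 'rV[R]_m => u 0 i) (cst (v 0 i)));
  [exact: coord_continuous|exact: cst_continuous].
Qed.

Lemma cvg_line x w : x + t *: w @[t --> (0 : R)] --> x.
Proof.
rewrite -[X in _ --> X]addr0 -(scale0r w).
by apply: cvgD; [exact: cvg_cst|apply: cvgZ; [exact: cvg_id|exact: cvg_cst]].
Qed.

Lemma near_line (P : set 'rV[R]_m) x w : (\forall z \near x, P z) ->
  \forall t \near 0^'+, P (x + t *: w).
Proof. exact: (cvg_at_right_filter (@cvg_line x w)). Qed.

Lemma local_minimizer_diff_ge0 f y w : differentiable f y ->
  local_minimizer f y -> 0 <= 'd f y w.
Proof.
move=> df fmin; have y0 : y + 0 *: w = y by rewrite scale0r addr0.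
have := @is_derive_line R m _ f y w 0; rewrite y0 => /(_ df) dh.
rewrite -oppr0; apply: derive_ge_right dh _; near=> t.
rewrite y0 mul0r subr0.
by near: t; exact: near_line fmin.
Unshelve. all: by end_near. Qed.

Lemma local_minimizer_grad f y : differentiable f y -> local_minimizer f y ->
  grad f y = 0.
Proof.
move=> df fmin; have := local_minimizer_diff_ge0 (- grad f y) df fmin.
rewrite diff_grad// dotrNr oppr_ge0 -norm2_sqr => g0.
have /eqP := le_anti (introT andP (conj g0 (sqr_ge0 _))).
rewrite sqrf_eq0 => /eqP n0; apply/eqP; rewrite -normr_le0.
by rewrite -n0 normr_le_norm2.
Qed.

(** If the Hessian had a direction [v] of negative curvature, the derivative of
    [f] along [v], which vanishes at [y], would be negative just to the right of
    [y]; by the mean value theorem [f] would then take values below [f y]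
    arbitrarily close to [y]. *)
Lemma local_minimizer_psd f y : (forall x, differentiable f x) ->
  differentiable (grad f) y -> local_minimizer f y -> psd (hess f y).
Proof.
move=> df dg fmin v; rewrite leNgt; apply/negP => neg.
have g0 := local_minimizer_grad (df y) fmin.
have := derivable_cvg_right (diff_derivable dg : derivable (grad f) y v).
rewrite deriveEjacobian// => gq.
have hq : dotr (t^-1 *: (grad f (t *: v + y) - grad f y)) v @[t --> 0^'+]
    --> dotr (v *m hess f y) v.
  exact: (cvg_comp _ _ gq (@continuous_dotrl v _)).
have kneg : \forall t \near 0^'+, dotr (grad f (y + t *: v)) v < 0.
  near=> t; have t0 : 0 < t by [].
  have : dotr (t^-1 *: (grad f (t *: v + y) - grad f y)) v < 0.
    by near: t; apply: (cvgr_lt _ hq).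
  by rewrite dotrZl pmulr_rlt0 ?invr_gt0// g0 subr0 addrC.
have fge : \forall t \near 0^'+, f y <= f (y + t *: v).
  exact: near_line fmin.
have [d /= d0 dP] : nbhs 0^'+ [set t | dotr (grad f (y + t *: v)) v < 0 /\
    f y <= f (y + t *: v)] by apply: filterI.
have dh s := is_derive_line (df (y + s *: v)).
have d20 : 0 < d / 2 by rewrite divr_gt0.
have inb t : 0 < t -> t <= d / 2 -> dotr (grad f (y + t *: v)) v < 0 /\
    f y <= f (y + t *: v).
  move=> t0 td; apply: dP => //=; rewrite sub0r normrN gtr0_norm//; lra.
have [|c] := MVT d20 (fun s _ => dh s).
  apply: continuous_subspaceT => s.
  by apply/differentiable_continuous/derivable1_diffP; have [] := dh s.
rewrite in_itv/= => /andP[c0 cd].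
rewrite scale0r addr0 subr0 diff_grad// => E.
have [_ ] := inb _ d20 (lexx _); have [+ _] := inb _ c0 (ltW cd).
by rewrite -subr_ge0 E => kc; rewrite pmulr_lge0// leNgt kc.
Unshelve. all: by end_near. Qed.

Lemma local_minimizer_stationary f y : (forall x, differentiable f x) ->
  differentiable (grad f) y -> local_minimizer f y ->
  second_order_stationary f y.
Proof.
move=> df dg fmin; split; first exact: local_minimizer_grad.
exact: local_minimizer_psd.
Qed.

End SecondOrder.

(** * Error bound at a local minimum *)

(** The absolute value makes the power continuous on the whole line, which is
    what minimization over a compact set asks for. *)
Lemma continuous_powR_norm (R : realType) (p : R) : 0 < p ->
  continuous (fun t : R => `|t| `^ p).
Proof.
move=> p0 t; have [->|t0] := eqVneq t 0; last first.
  apply: (@continuous_comp R R R (fun t : R => `|t|) (fun t : R => t `^ p)).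
    exact: norm_continuous.
  apply/differentiable_continuous/derivable1_diffP.
  by apply: ex_derive; apply: is_derive1_powR; rewrite normr_gt0.
rewrite /continuous_at normr0 powR0 ?gt_eqF//; apply/cvgrPdist_lt => e e0.
have d0 : 0 < e `^ p^-1 by rewrite powR_gt0.
near=> s.
have sd : `|s| < e `^ p^-1.
  rewrite -[s]subr0 distrC; near: s; exact: cvgr_dist_lt.
rewrite sub0r normrN ger0_norm ?powR_ge0//.
rewrite -[ltRHS](powRr1 (ltW e0)) -(mulVf (lt0r_neq0 p0)) powRrM.
by apply: gt0_ltr_powR; rewrite ?nnegrE ?powR_ge0.
Unshelve. all: by end_near. Qed.

Section ErrorBound.
Context {R : realType} {m : nat} (f : 'rV[R]_m -> R).
Implicit Types (x y z : 'rV[R]_m).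

(** When [y] minimizes [(f - a) ^ p] up to a perturbation of slope [s], the
    gradient of [(f - a) ^ p] at [y] has norm at most [s]: move from [y] in the
    direction [- grad f y]. The perturbation is measured in the sup norm, which
    is below the Euclidean one. *)
Lemma slope_powR_le y (a p s : R) : differentiable f y -> 0 <= s -> a < f y ->
    (\forall z \near y, (f y - a) `^ p <= (f z - a) `^ p + s * `|z - y|) ->
  p * (f y - a) `^ (p - 1) * norm2 (grad f y) <= s.
Proof.
move=> df s0 ay ymin; set g := grad f y.
have y0 w : y + 0 *: w = y by rewrite scale0r addr0.
pose h (t : R) := f (y + t *: - g) - a.
have h0 : h 0 = f y - a by rewrite /h y0.
have dh : is_derive (0 : R) (1 : R) h (- norm2 g ^+ 2).
  have := @is_derive_line R m _ f y (- g) 0; rewrite y0 => /(_ df) dl.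
  by apply: is_derive_eq; rewrite subr0 diff_grad// dotrNr norm2_sqr.
have dp : is_derive (h 0) (1 : R) (fun t : R => t `^ p)
    (p * (f y - a) `^ (p - 1)).
  by rewrite h0; apply: is_derive1_powR; rewrite subr_gt0.
have := derive_ge_right (b := s * `|g|) (is_derive1_comp dp dh).
rewrite /= h0 mulrN lerN2 => ub.
have {}ub : p * (f y - a) `^ (p - 1) * norm2 g ^+ 2 <= s * `|g|.
  apply: ub.
  near=> t; have t0 : 0 < t by [].
  rewrite lerBlDr -mulrA [`|g| * t]mulrC.
  have -> : t * `|g| = `|(y + t *: - g) - y|.
    by rewrite addrC addKr normrZ normrN gtr0_norm.
  near: t; pose P z := (f y - a) `^ p <= (f z - a) `^ p + s * `|z - y|.
  exact: (@near_line _ _ P).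
move: ub; rewrite expr2 mulrA => ub.
have [->|n0] := eqVneq (norm2 g) 0; first by rewrite mulr0.
have npos : 0 < norm2 g by rewrite lt_neqAle eq_sym n0 norm2_ge0.
rewrite -(ler_pM2r npos); apply: le_trans ub _.
by rewrite ler_wpM2l// normr_le_norm2.
Unshelve. all: by end_near. Qed.

(** The gradient inequality says that [F := (f - f xbar) ^ p] has slope at least
    [p / C] wherever it is positive. Minimize [F + s * `|_ - x|] with half that
    slope, [s = p / (2 * C)], over a closed ball (this is Ekeland's principle,
    where compactness provides an exact minimizer [y]). Comparing with the
    value at [x] bounds [s * `|x - y|] by [F x], so [y] stays inside the ball
    when [F x] is small; and [F y > 0] is impossible, because the slope of [F]
    at [y] would be at most [s]. *)
Lemma near_minimizer x xbar (p C r : R) :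
    0 < p -> 0 < C -> (forall z, differentiable f z) ->
    (forall z, `|z - xbar| < r -> f xbar <= f z) ->
    (forall z, `|z - xbar| < r -> f xbar < f z -> f z <= f x ->
       (f z - f xbar) `^ (1 - p) <= C * norm2 (grad f z)) ->
    `|x - xbar| < r / 4 ->
    (f x - f xbar) `^ p < p / (2 * C) * (r / 4) ->
  exists y, [/\ f y = f xbar, `|y - xbar| < r &
    p / (2 * C) * `|x - y| <= (f x - f xbar) `^ p].
Proof.
move=> p0 C0 df fmin KL xr Fx; set s := p / (2 * C) in Fx *.
have s0 : 0 < s by rewrite divr_gt0// mulr_gt0.
have r0 : 0 < r by rewrite -(@pmulr_lgt0 _ 4^-1) ?invr_gt0//; exact: le_lt_trans xr.
pose A := [set z | `|z - xbar| <= r / 2].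
have AE : A = closed_ball_ (fun u => `|u|) xbar (r / 2).
  by apply/seteqP; split => z; rewrite /closed_ball_ /A /= distrC.
have Ar z : A z -> `|z - xbar| < r by rewrite /A/= => zr; lra.
have xA : A x by rewrite /A /=; lra.
have cA : compact A.
  rewrite AE; apply: bounded_closed_compact; last exact: closed_closed_ball_.
  exists (`|xbar| + r / 2); split; first exact: num_real.
  move=> M Mr z /= zr; apply: le_trans (ltW Mr).
  by rewrite -lerBlDl (le_trans (lerB_dist _ _))// distrC.
pose H z := `|f z - f xbar| `^ p + s * `|z - x|.
have cH : continuous H.
  move=> z; apply: (@continuousD _ _ _ (fun z => `|f z - f xbar| `^ p)).
    apply: (@continuous_comp _ _ _ (fun z => f z - f xbar)
      (fun t : R => `|t| `^ p)).
      apply: (@continuousB _ _ _ f (cst (f xbar))); last exact: cst_continuous.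
      exact: differentiable_continuous.
    exact: continuous_powR_norm.
  apply: (@continuousM _ _ (cst s) (fun z => `|z - x|)).
    exact: cst_continuous.
  apply: (@continuous_comp _ _ _ (fun z => z - x) (fun t => `|t|)).
    apply: (@continuousB _ _ _ id (cst x)); last exact: cst_continuous.
    by move=> ?.
  exact: norm_continuous.
have [y + ymin] := compact_EVT_min (ex_intro _ x xA) cA (continuous_subspaceT cH).
rewrite inE => yA.
have absA z : A z -> `|f z - f xbar| = f z - f xbar.
  by move=> zA; rewrite ger0_norm// subr_ge0 fmin// Ar.
have Fxy : (f y - f xbar) `^ p + s * `|y - x| <= (f x - f xbar) `^ p.
  have := ymin x; rewrite inE => /(_ xA).
  by rewrite /H !absA// subrr normr0 mulr0 addr0.
have sxy : s * `|x - y| <= (f x - f xbar) `^ p.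
  by rewrite distrC; apply: le_trans Fxy; rewrite lerDr powR_ge0.
have yr : `|y - xbar| < r / 2.
  have : `|x - y| < r / 4 by rewrite -(ltr_pM2l s0); exact: le_lt_trans Fx.
  have := ler_distD x y xbar; rewrite (distrC y x); lra.
exists y; split; [|exact: Ar|exact: sxy].
apply/eqP; rewrite eq_le (fmin _ (Ar _ yA)) andbT leNgt; apply/negP => fy.
have fyx : f y <= f x.
  rewrite leNgt; apply/negP => fxy.
  have : (f x - f xbar) `^ p < (f y - f xbar) `^ p.
    rewrite gt0_ltr_powR// ?nnegrE ?subr_ge0 ?fmin ?ltrD2r//; exact: Ar.
  by apply/negP; rewrite -leNgt; apply: le_trans Fxy; rewrite lerDl mulr_ge0// ltW.
have := KL _ (Ar _ yA) fy fyx.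
have := @slope_powR_le y (f xbar) p s (df y) (ltW s0) fy.
have S0 : 0 < (f y - f xbar) `^ (1 - p) by rewrite powR_gt0// subr_gt0.
have -> : p - 1 = - (1 - p) by rewrite opprB.
rewrite powRN; move: S0; set S := _ `^ (1 - p); set g := norm2 _ => S0 slope KLy.
have sl : p * S^-1 * g <= s.
  apply: slope; near=> z.
  have zA : A z by rewrite /A /= ltW//; near: z; exact: near_in_ball.
  have := ymin z; rewrite inE => /(_ zA); rewrite /H !absA// => Fyz.
  have := ler_distD y z x; rewrite -(ler_pM2l s0) mulrDr; lra.
have : p * S <= C * (s * S).
  apply: le_trans (_ : p * (C * g) <= _); first by rewrite ler_pM2l.
  rewrite mulrCA ler_pM2l// -ler_pdivrMr// mulrAC; exact: sl.
rewrite mulrA ler_pM2r// /s.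
have -> : C * (p / (2 * C)) = p / 2 by field; rewrite gt_eqF.
lra.
Unshelve. all: by end_near. Qed.

End ErrorBound.

(** * From the gradient inequality to subregularity *)

Section Subregularity.
Context {R : realType}.

(** Near [xbar] the points with value [f xbar] are local minimizers, hence
    second-order stationary, so [near_minimizer] bounds the distance [D] from [x]
    to the stationary set by [M * (f x - f xbar) ^ (1 - theta)]. Raised to the
    power [theta / (1 - theta)], this becomes a bound by a multiple of
    [(f x - f xbar) ^ theta], which the gradient inequality controls. *)
Lemma gradient_KL_subregular m (f : 'rV[R]_m -> R) (xbar : 'rV[R]_m)
    (theta C eta : R) :
    C2_fun f -> 0 <= theta < 1 -> 0 < C -> 0 < eta ->
    local_minimizer f xbar ->
    (\forall z \near xbar, f xbar < f z -> f z < f xbar + eta ->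
       (f z - f xbar) `^ theta <= C * norm2 (grad f z)) ->
  gen_metric_subregular (grad f) xbar (psi_of theta)
    (second_order_stationary f).
Proof.
move=> [df [dg _]] /andP[t0 t1] C0 eta0 fmin KL.
pose p := 1 - theta; have p0 : 0 < p by rewrite subr_gt0.
have cf : {for xbar, continuous f} by exact: differentiable_continuous.
have [r /= r0 rP] : exists2 r : R, 0 < r & forall z, `|z - xbar| < r ->
    f xbar <= f z /\ (f xbar < f z -> f z < f xbar + eta ->
      (f z - f xbar) `^ theta <= C * norm2 (grad f z)).
  have /nbhs_ballP[r /= r0 rP] : nbhs xbar [set z | f xbar <= f z /\
      (f xbar < f z -> f z < f xbar + eta ->
      (f z - f xbar) `^ theta <= C * norm2 (grad f z))] by apply: filterI.
  by exists r => // z zr; apply: rP; rewrite -ball_normE/= distrC.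
have stat y : f y = f xbar -> `|y - xbar| < r -> second_order_stationary f y.
  move=> fy yr; apply: local_minimizer_stationary => //; near=> z.
  by rewrite fy; apply: (rP z _).1; near: z; exact: near_in_ball.
pose s := p / (2 * C); have s0 : 0 < s by rewrite divr_gt0// mulr_gt0.
(* [K] compares the Euclidean norm with the sup norm; adding 1 keeps it
   positive in dimension 0. *)
pose K : R := Num.sqrt m%:R + 1.
have K0 : 0 < K by rewrite ltr_wpDl ?sqrtr_ge0.
pose q := theta / p; pose M := K / s.
have M0 : 0 < M by rewrite divr_gt0.
have [d d0 dP] : exists2 d : R, 0 < d & forall x, norm2 (x - xbar) < d ->
    [/\ `|x - xbar| < r / 4, f x < f xbar + eta &
      `|f x - f xbar| `^ p < s * (r / 4)].
  apply: norm2_nbhs; near=> x; split.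
  - by rewrite distrC; near: x; apply: cvgr_dist_lt => //; rewrite divr_gt0.
  - by near: x; apply: (cvgr_lt _ cf); rewrite ltrDl.
  - near: x.
    have : `|f x - f xbar| `^ p @[x --> xbar] --> `|f xbar - f xbar| `^ p.
      apply: (@continuous_comp _ _ _ (fun z => f z - f xbar)
        (fun t : R => `|t| `^ p)).
        apply: (@continuousB _ _ _ f (cst (f xbar))) => //.
        exact: cst_continuous.
      exact: continuous_powR_norm.
    rewrite subrr normr0 powR0 ?gt_eqF// => /cvgr_lt; apply.
    by rewrite mulr_gt0// divr_gt0.
exists (M `^ q * C), d; split => //; first by rewrite mulr_gt0 ?powR_gt0.
move=> x /dP[xr xeta Fx].
have xr' : `|x - xbar| < r by lra.
have [fge KLx] := rP _ xr'.
have rhs0 : 0 <= M `^ q * C * norm2 (grad f x).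
  by rewrite mulr_ge0 ?norm2_ge0// mulr_ge0 ?powR_ge0// ltW.
rewrite /psi_of; case: eqVneq => [//|dn0].
move: fge; rewrite le_eqVlt => /predU1P[fx|fx].
  move/eqP: dn0; case; apply/eqP; rewrite eq_le.
  have := dist2_le x (stat _ (esym fx) xr').
  by rewrite subrr norm2_0 andbC.
have S0 : 0 <= f x - f xbar by rewrite subr_ge0 ltW.
rewrite ger0_norm// in Fx.
have [||y [fy yr xy]] := @near_minimizer R m f x xbar p C r p0 C0 df _ _ xr Fx.
- by move=> z /rP[].
- move=> z /rP[_ KLz] fz fzx; rewrite /p subKr; apply: KLz => //.
  exact: le_lt_trans xeta.
have /andP[dge dle] := dist2_le x (stat _ fy yr).
rewrite -/s in xy; set D := fine _ in dge dle dn0 *.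
have DM : D <= M * (f x - f xbar) `^ p.
  apply: le_trans dle _; apply: le_trans (norm2_le_normr _) _.
  apply: (@le_trans _ _ (K * `|x - y|)); first by rewrite ler_wpM2r ?lerDl.
  by rewrite /M -mulrA ler_pM2l// ler_pdivlMl.
have q0 : 0 <= q by rewrite divr_ge0// ltW.
apply: le_trans (ge0_ler_powR q0 _ _ DM) _; rewrite ?nnegrE//.
  by rewrite mulr_ge0 ?powR_ge0// ltW.
rewrite powRM ?powR_ge0 ?(ltW M0)// -powRrM.
have -> : p * q = theta by rewrite /q mulrC divfK ?gt_eqF.
by rewrite -mulrA ler_pM2l ?powR_gt0// KLx.
Unshelve. all: by end_near. Qed.

(** * The KL property and limiting subgradients *)

(** The KL property bounds a distance to the limiting subdifferential from
    below, so each single limiting subgradient inherits the bound; for the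
    subsequent uses it is enough to exhibit one. *)
Lemma KL_powR_le n (phi : 'rV[R]_n -> R) (ybar : 'rV[R]_n) (theta : R) :
    theta < 1 -> KL_property (EFin \o phi) ybar theta ->
  exists C eta eps : R, [/\ 0 < C, 0 < eta, 0 < eps &
    forall y v, norm2 (y - ybar) < eps -> phi ybar < phi y ->
      phi y < phi ybar + eta -> limiting_subdiff (EFin \o phi) y v ->
    (phi y - phi ybar) `^ theta <= C * norm2 v].
Proof.
move=> t1 [c [eta [eps [c0 eta0 eps0 KL]]]].
have p0 : 0 < 1 - theta by rewrite subr_gt0.
exists (c * (1 - theta)), eta, eps; split => //; first exact: mulr_gt0.
move=> y v yeps lty yeta yv.
have s0 : 0 < phi y - phi ybar by rewrite subr_gt0.
have := KL y yeps; rewrite /= -EFinD !lte_fin => /(_ lty yeta).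
have -> : derive1 (fun t : R => c * t `^ (1 - theta)) (phi y - phi ybar)
    = c * ((1 - theta) * (phi y - phi ybar) `^ (1 - theta - 1)).
  have [_ E] := is_deriveZ c (is_derive1_powR (1 - theta) s0).
  by rewrite derive1E; exact: E.
have -> : 1 - theta - 1 = - theta by rewrite addrAC subrr add0r.
have dv : (dist2 0 (limiting_subdiff (EFin \o phi) y) <= (norm2 v)%:E)%E.
  by apply: ereal_inf_lbound; exists v => //; rewrite sub0r norm2N.
rewrite powRN; set S := _ `^ theta => KLy.
have S0 : 0 < S by rewrite powR_gt0.
have D0 : 0 < c * ((1 - theta) / S) by rewrite mulr_gt0// divr_gt0.
have : (1 <= (c * ((1 - theta) / S) * norm2 v)%:E)%E.
  by apply: le_trans KLy _; rewrite [leRHS]EFinM lee_pmul2l.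
rewrite lee_fin -(ler_pM2r S0) mul1r => /le_trans; apply.
by rewrite le_eqVlt; apply/orP; left; apply/eqP; field; rewrite gt_eqF.
Qed.

Lemma regular_limiting_subdiff n (h : 'rV[R]_n -> \bar R) (x v : 'rV[R]_n) :
  regular_subdiff h x v -> limiting_subdiff h x v.
Proof.
move=> hv; split; first by case: hv.
by exists (fun=> x), (fun=> v); split => //; exact: cvg_cst.
Qed.

Lemma grad_limiting_subdiff n (f : 'rV[R]_n -> R) (x : 'rV[R]_n) :
  differentiable f x -> limiting_subdiff (EFin \o f) x (grad f x).
Proof.
move=> df; apply: regular_limiting_subdiff; split=> // e e0.
have /eqaddoP/(_ _ e0) lin := diff_locally df.
have c0 : z - x @[z --> x] --> (0 : 'rV[R]_n).
  by rewrite -(subrr x); apply: (@continuousB _ _ _ id (cst x));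
    [move=> ?|exact: cst_continuous].
have {}lin : \forall z \near x,
    `|f (z - x + x) - (f x + 'd f x (z - x))| <= e * `|z - x| := c0 _ lin.
near=> z.
have : `|f z - (f x + 'd f x (z - x))| <= e * `|z - x|.
  by rewrite -[X in f X - _](subrK x); near: z.
rewrite -EFinD lee_fin -diff_grad// ler_norml => /andP[+ _].
have : e * `|z - x| <= e * norm2 (z - x) by rewrite ler_pM2l// normr_le_norm2.
lra.
Unshelve. all: by end_near. Qed.

End Subregularity.

(** * Eigenvalues, right inverses, matrices near the identity *)

Section Matrices.
Context {R : realType}.

Lemma mulmx_norm_le k m n (A : 'M[R]_(k, m)) (B : 'M[R]_(m, n)) :
  `|A *m B| <= m%:R * `|A| * `|B|.
Proof.
rewrite [leLHS]/Num.Def.normr /= mx_normrE; apply: bigmax_le => [|[i j] _ /=].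
  by rewrite mulr_ge0// mulr_ge0.
rewrite mxE; apply: le_trans (ler_norm_sum _ _ _) _.
have -> : m%:R * `|A| * `|B| = \sum_(l < m) `|A| * `|B|.
  by rewrite sumr_const card_ord -mulrA mulr_natl.
by apply: ler_sum => l _; rewrite normrM ler_pM ?normr_mxE.
Qed.

(** A matrix close to the identity is bounded below, with a constant that does
    not depend on the matrix. *)
Lemma norm_le_mulmx n (A : 'M[R]_n) (u : 'rV[R]_n) :
  n%:R * `|A - 1%:M| <= 2^-1 -> `|u| <= 2 * `|u *m A|.
Proof.
move=> A1; have : `|u *m (A - 1%:M)| <= 2^-1 * `|u|.
  apply: le_trans (mulmx_norm_le _ _) _.
  by rewrite mulrAC ler_wpM2r.
rewrite mulmxBr mulmx1 => uA.
have := lerB_dist u (u *m A); rewrite distrC; lra.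
Qed.

Lemma unitmx_near1 n (A : 'M[R]_n) :
  n%:R * `|A - 1%:M| <= 2^-1 -> A \in unitmx.
Proof.
move=> A1; rewrite -row_free_unit -kermx_eq0; apply/rowV0P => u /sub_kermxP uA.
apply/eqP; rewrite -normr_le0; apply: le_trans (norm_le_mulmx u A1) _.
by rewrite uA normr0 mulr0.
Qed.

Lemma normr_trmx k n (A : 'M[R]_(k, n)) : `|A^T| <= `|A|.
Proof.
rewrite [leLHS]/Num.Def.normr /= mx_normrE; apply: bigmax_le => // -[i j] _ /=.
by rewrite mxE normr_mxE.
Qed.

Lemma psd_lambda_min_ge0 n (A : 'M[R]_n) : psd A -> 0 <= lambda_min A.
Proof.
move=> Apsd; rewrite /lambda_min; set E := [set _ | _].
have [->|/set0P E0] := eqVneq E set0; first by rewrite inf0.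
apply: lb_le_inf => // a /eigenvalueP[v vA v0].
have vv0 : 0 < dotr v v.
  rewrite -norm2_sqr exprn_gt0//; apply: lt_le_trans (normr_le_norm2 _).
  by rewrite normr_gt0.
by have := Apsd v; rewrite vA dotrZl pmulr_lge0.
Qed.

Lemma surj_right_inverse m n (J : 'M[R]_(m, n)) :
  (forall d : 'rV[R]_n, exists w : 'rV[R]_m, w *m J = d) ->
  exists B : 'M[R]_(n, m), B *m J = 1%:M.
Proof.
move=> surj; have [w wJ] := choice (fun i => surj (delta_mx 0 i : 'rV[R]_n)).
exists (\matrix_i w i); apply/row_matrixP => i.
by rewrite row_mul rowK wJ row1.
Qed.

End Matrices.

(** * Convex functions *)

Section Convex.
Context {R : realType} {n : nat} (phi : 'rV[R]_n -> R).
Context (cphi : convex_function setT phi).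

Lemma convex_le (a : R) (x y : 'rV[R]_n) : 0 <= a <= 1 ->
  phi (a *: x + (1 - a) *: y) <= a * phi x + (1 - a) * phi y.
Proof.
move=> /andP[a0 a1].
exact: (cphi (Itv01 a0 a1) (mem_setT x) (mem_setT y)).
Qed.

Lemma convex_usc_line (y w : 'rV[R]_n) (e : R) : 0 < e ->
  exists2 d : R, 0 < d & forall t, `|t| < d -> phi (y + t *: w) < phi y + e.
Proof.
move=> e0.
pose M := `|phi (y + w) - phi y| + `|phi (y - w) - phi y| + 1.
have M0 : 0 < M by rewrite ltr_wpDl// addr_ge0.
exists (Num.min 1 (e / M)); first by rewrite lt_min ltr01 divr_gt0.
move=> t; rewrite lt_min => /andP[t1]; rewrite ltr_pdivlMr// => tM.
have key (u : 'rV[R]_n) : `|phi (y + u) - phi y| <= M ->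
    phi (y + `|t| *: u) < phi y + e.
  move=> uM; have /convex_le := introT andP (conj (normr_ge0 t) (ltW t1)).
  move=> /(_ (y + u) y).
  rewrite (_ : `|t| *: (y + u) + _ = y + `|t| *: u); last first.
    by rewrite scalerDr scalerBl scale1r addrC addrA subrK.
  move=> /le_lt_trans; apply.
  have : `|t| * (phi (y + u) - phi y) <= `|t| * M.
    by rewrite ler_wpM2l//; apply: le_trans uM; exact: ler_norm.
  lra.
have [t0|t0] := leP 0 t.
  by rewrite -{1}(ger0_norm t0); apply: key; rewrite /M -addrA lerDl addr_ge0.
rewrite -[t]opprK -(ltr0_norm t0) scaleNr -scalerN; apply: key.
by rewrite /M addrAC lerDr addr_ge0.
Qed.

(** The case of a single direction extends to all of them by adding one
    coordinate at a time: [y + a + b] is the midpoint of [y + 2 * a] and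
    [y + 2 * b]. *)
Lemma convex_usc (y : 'rV[R]_n) (e : R) : 0 < e ->
  \forall z \near y, phi z < phi y + e.
Proof.
move=> e0.
have [d d0 dP] : exists2 d : R, 0 < d & forall c : 'I_n -> R,
    (forall i, `|c i| < d) ->
    phi (y + \sum_i c i *: delta_mx 0 i) < phi y + e.
  elim: (index_enum _) => [|i s [d d0 IH]].
    by exists 1 => // c _; rewrite big_nil addr0 ltrDl.
  have [d1 d10 line] := convex_usc_line y (delta_mx 0 i) e0.
  exists (Num.min d d1 / 2); first by rewrite divr_gt0// lt_min d0.
  move=> c cd; have {}cd j : `|2 * c j| < Num.min d d1.
    by rewrite normrM ger0_norm// mulrC -ltr_pdivlMr.
  rewrite big_cons.
  have -> : y + (c i *: delta_mx 0 i + \sum_(j <- s) c j *: delta_mx 0 j) =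
      2^-1 *: (y + (2 * c i) *: delta_mx 0 i) +
      (1 - 2^-1) *: (y + \sum_(j <- s) (2 * c j) *: delta_mx 0 j).
    under [in RHS]eq_bigr do rewrite -scalerA.
    rewrite -scaler_sumr -scalerA.
    move: (c i *: _) (\sum_(j <- s) _) => a b.
    by apply/rowP => k; rewrite !mxE; field.
  apply: le_lt_trans (convex_le _ _ _) _; first by lra.
  have h1 : phi (y + (2 * c i) *: delta_mx 0 i) < phi y + e.
    by apply: line; have := cd i; rewrite lt_min => /andP[].
  have h2 : phi (y + \sum_(j <- s) (2 * c j) *: delta_mx 0 j) < phi y + e.
    apply: (IH (fun j => 2 * c j)) => j.
    by have := cd j; rewrite lt_min => /andP[].
  lra.
near=> z; have zd : `|y - z| < d by near: z; exact: cvgr_dist_lt.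
rewrite -[z](subrK y) addrC [z - y]row_sum_delta; apply: dP => i.
by apply: le_lt_trans (normr_mxE _ _ _) _; rewrite distrC.
Unshelve. all: by end_near. Qed.

(** Write [g (x + t * w) = g x + t * q t]. For [0 < t < 1] this point is a convex
    combination of [g x + q t] and [g x], so the difference quotient of
    [phi \o g] is at most [phi (g x + q t) - phi (g x)]. Let [t] tend to 0: [q t]
    tends to ['d g x w], and upper semicontinuity of [phi] suffices. *)
Lemma convex_comp_diff_le m (g : 'rV[R]_m -> 'rV[R]_n) (x w : 'rV[R]_m) :
    differentiable (phi \o g) x -> differentiable g x ->
  'd (phi \o g) x w <= phi (g x + 'd g x w) - phi (g x).
Proof.
move=> df dg; apply/ler_addgt0Pr => e e0.
have := derivable_cvg_right (diff_derivable df : derivable (phi \o g) x w).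
have := derivable_cvg_right (diff_derivable dg : derivable g x w).
rewrite !deriveE// => gq fq.
rewrite -(cvg_lim _ fq)//; apply: limr_le; first by apply/cvg_ex; eexists; exact: fq.
have zq : g x + t^-1 *: (g (t *: w + x) - g x) @[t --> 0^'+] --> g x + 'd g x w.
  by apply: cvgD; [exact: cvg_cst|exact: gq].
have zlt : \forall t \near 0^'+,
    phi (g x + t^-1 *: (g (t *: w + x) - g x)) < phi (g x + 'd g x w) + e.
  exact: zq _ (convex_usc _ e0).
near=> t; have t0 : 0 < t by [].
have t1 : t < 1 by near: t; exact: nbhs_right_lt.
have : phi (g x + t^-1 *: (g (t *: w + x) - g x)) < phi (g x + 'd g x w) + e.
  by near: t.
set z := g x + _ => zt.
have gE : g (t *: w + x) = t *: z + (1 - t) *: g x.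
  rewrite /z; move: (g _) (g x) => a b.
  by apply/rowP => k; rewrite !mxE; field; rewrite gt_eqF.
have /(convex_le z (g x)) : 0 <= t <= 1 by rewrite !ltW.
rewrite -gE /GRing.scale /= => cz; rewrite ler_pdivrMl//.
have : t * phi z <= t * (phi (g x + 'd g x w) + e) by rewrite ler_pM2l// ltW.
lra.
Unshelve. all: by end_near. Qed.

End Convex.

(** * Convex functions composed with submersions *)

Section Composite.
Context {R : realType} {m n : nat}.
Context (phi : 'rV[R]_n -> R) (g : 'rV[R]_m -> 'rV[R]_n).
Context (cphi : convex_function setT phi).

Lemma jacobian_right_inverse (x : 'rV[R]_m) : differentiable g x ->
  set_surj setT setT ('d g x) -> exists B, B *m jacobian g x = 1%:M.
Proof.
move=> dg surj; apply: surj_right_inverse => d; have [w _ wd] := surj d I.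
by exists w; rewrite -deriveEjacobian// deriveE.
Qed.

(** Apply [convex_comp_diff_le] to [w = (z - g x) B], which the derivative of [g]
    maps to [z - g x]. The gradient of the composite thus yields an explicit
    subgradient of [phi]. *)
Lemma convex_comp_subgradient (x : 'rV[R]_m) (B : 'M[R]_(n, m)) :
    differentiable (phi \o g) x -> differentiable g x ->
    B *m jacobian g x = 1%:M ->
  forall z, phi (g x) + dotr (grad (phi \o g) x *m B^T) (z - g x) <= phi z.
Proof.
move=> df dg BJ z; have := convex_comp_diff_le cphi ((z - g x) *m B) df dg.
rewrite -[X in _ <= phi (_ + X) - _]deriveE// deriveEjacobian// -mulmxA BJ mulmx1.
rewrite diff_grad// [g x + _]addrC subrK lerBrDl.
by rewrite dotr_mulmx trmxK.
Qed.

Lemma convex_comp_critical_min (x : 'rV[R]_m) (B : 'M[R]_(n, m)) :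
    differentiable (phi \o g) x -> differentiable g x ->
    B *m jacobian g x = 1%:M -> grad (phi \o g) x = 0 ->
  forall z, phi (g x) <= phi z.
Proof.
move=> df dg BJ g0 z; have := convex_comp_subgradient df dg BJ z.
by rewrite g0 mul0mx dotr0l addr0.
Qed.

(** For [z] near [x], a right inverse [B0] of the Jacobian at [x] makes
    [A = B0 *m jacobian g z]
    close to the identity, so [invmx A *m B0] is a right inverse of the Jacobian
    at [z]. The resulting subgradient [v] satisfies [v A^T = grad B0^T], and
    [norm_le_mulmx] turns this into a bound on [v] that is uniform in [z]. *)
Lemma near_convex_comp_subgradient (x : 'rV[R]_m) :
    (forall z, differentiable (phi \o g) z) -> C1_map g ->
    set_surj setT setT ('d g x) ->
  exists2 L : R, 0 < L & \forall z \near x, exists2 v,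
    limiting_subdiff (EFin \o phi) (g z) v &
    norm2 v <= L * norm2 (grad (phi \o g) z).
Proof.
move=> df [dg cJ] surj.
have [B0 B0J] := jacobian_right_inverse (dg x) surj.
pose L := Num.sqrt n%:R * (2 * (m%:R * `|B0^T|)) + 1.
have K0 : 0 <= Num.sqrt n%:R * (2 * (m%:R * `|B0^T|)).
  by rewrite mulr_ge0 ?sqrtr_ge0// mulr_ge0// mulr_ge0.
exists L; first by rewrite ltr_wpDl.
pose b := n%:R * (m%:R * `|B0|) + 1.
have b0 : 0 < b by rewrite ltr_wpDl// mulr_ge0// mulr_ge0.
near=> z.
have Jz : `|jacobian g x - jacobian g z| < (2 * b)^-1.
  near: z; apply: cvgr_dist_lt; first exact: cJ.
  by rewrite invr_gt0 mulr_gt0.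
pose A := B0 *m jacobian g z.
have A1 : n%:R * `|A - 1%:M| <= 2^-1.
  rewrite /A -B0J -mulmxBr.
  apply: (@le_trans _ _ (n%:R * (m%:R * `|B0| * `|jacobian g z - jacobian g x|))).
    by rewrite ler_wpM2l//; exact: mulmx_norm_le.
  rewrite mulrA distrC.
  apply: (@le_trans _ _ (b * (2 * b)^-1)); last first.
    by rewrite invfM mulrCA mulfV ?gt_eqF// mulr1.
  by apply: ler_pM; rewrite ?mulr_ge0 ?lerDl//; exact: ltW.
have Au := unitmx_near1 A1.
have BJ : invmx A *m B0 *m jacobian g z = 1%:M by rewrite -mulmxA mulVmx.
exists (grad (phi \o g) z *m (invmx A *m B0)^T).
  apply: regular_limiting_subdiff; split => // e e0; near=> y.
  rewrite -EFinD lee_fin; apply: le_trans (convex_comp_subgradient _ _ BJ y) => //.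
  by rewrite lerD2l gerBl mulr_ge0 ?norm2_ge0// ltW.
set v := _ *m _^T; set G := grad _ _ in v *.
have AT1 : n%:R * `|A^T - 1%:M| <= 2^-1.
  apply: le_trans A1; rewrite ler_wpM2l//.
  have -> : A^T - 1%:M = (A - 1%:M)^T by rewrite linearB /= trmx1.
  exact: normr_trmx.
have vA : v *m A^T = G *m B0^T.
  by rewrite /v -mulmxA -trmx_mul mulmxA mulmxV// mul1mx.
apply: le_trans (norm2_le_normr _) _.
apply: (@le_trans _ _ (Num.sqrt n%:R * (2 * (m%:R * `|B0^T|)) * norm2 G));
  last first.
  by rewrite ler_wpM2r ?norm2_ge0// lerDl.
rewrite -!mulrA ler_wpM2l ?sqrtr_ge0//.
apply: le_trans (norm_le_mulmx _ AT1) _; rewrite vA ler_pM2l//.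
apply: le_trans (mulmx_norm_le _ _) _.
by rewrite -mulrA ler_wpM2l// mulrC ler_wpM2l// normr_le_norm2.
Unshelve. all: by end_near. Qed.

End Composite.

(** * Strict saddles and convex composites *)

Theorem corollary6p5 (R : realType) (m : nat) (f : 'rV[R]_m -> R)
    (xbar : 'rV[R]_m) (theta : R)
    (f_C2 : C2_fun f)
    (xbar_Theta : second_order_stationary f xbar)
    (theta_ge0 : 0 <= theta) (theta_lt1 : theta < 1)
    (H : (strict_saddle f xbar /\ KL_property (EFin \o f) xbar theta)
      \/ (exists (n : nat) (phi : 'rV[R]_n -> R) (g : 'rV[R]_m -> 'rV[R]_n),
            [/\ f = phi \o g,
                convex_function setT phi,
                KL_property (EFin \o phi) (g xbar) theta,
                C1_map g &
                set_surj setT setT ('d g xbar)])) :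
  gen_metric_subregular (grad f) xbar (psi_of theta)
    (second_order_stationary f).
Proof.
have t01 : 0 <= theta < 1 by rewrite theta_ge0.
have [df _] := f_C2; have [g0 Hpsd] := xbar_Theta.
case: H => [[[_ saddle] KL]|[n [phi [g [fE cphi KL C1g surj]]]]].
  (* The Hessian at [xbar] is positive semidefinite, so its least eigenvalue
     is not negative and the strict saddle property leaves a minimizer. *)
  have fmin : local_minimizer f xbar.
    case: saddle => // neg; have := psd_lambda_min_ge0 Hpsd.
    by rewrite leNgt neg.
  have [C [eta [eps [C0 eta0 eps0 KLP]]]] := KL_powR_le theta_lt1 KL.
  apply: (gradient_KL_subregular f_C2 t01 C0 eta0 fmin); near=> z.
  move=> fz zeta; apply: KLP => //; last exact: grad_limiting_subdiff.
  by near: z; exact: near_norm2.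
subst f; have [dg _] := C1g.
have fmin : local_minimizer (phi \o g) xbar.
  have [B BJ] := jacobian_right_inverse (dg xbar) surj.
  by near=> z; exact: (convex_comp_critical_min cphi (df xbar) (dg xbar) BJ g0).
have [C [eta [eps [C0 eta0 eps0 KLP]]]] := KL_powR_le theta_lt1 KL.
have [L L0 subg] := near_convex_comp_subgradient cphi df C1g surj.
have gnear : \forall z \near xbar, norm2 (g z - g xbar) < eps.
  exact: (differentiable_continuous (dg xbar) (near_norm2 (g xbar) eps0)).
apply: (gradient_KL_subregular f_C2 t01 (mulr_gt0 C0 L0) eta0 fmin); near=> z.
move=> /= fz zeta.
have [v vsub vL] : exists2 v, limiting_subdiff (EFin \o phi) (g z) v &
    norm2 v <= L * norm2 (grad (phi \o g) z) by near: z.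
apply: le_trans (KLP (g z) v _ fz zeta vsub) _; last by rewrite -mulrA ler_pM2l.
by near: z.
Unshelve. all: by end_near. Qed.
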